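(* Let $\lambda\in\mathbb{R}$ and $r\in\mathbb{N}\cup\{0\}$. For every integer $n\ge0$, the following identities hold (as polynomials in the variable $x$): $$(x+r|\lambda)_n=\sum_{k=0}^{n}S_{2,r}(n+r,k+r|\lambda)\,(x)_k=\sum_{k=0}^{n}\lambda^{n-k}S_1(n,k)(x+r)^k.$$
   Context: All generating functions are formal power series in $t$. The degenerate factorials are $(y|\lambda)_0=1$ and $(y|\lambda)_n=y(y-\lambda)(y-2\lambda)\cdots(y-(n-1)\lambda)$ for $n\ge1$. For a number $y$, $(1+\lambda t)^{y/\lambda}$ denotes the formal power series $\sum_{n\ge0}(y|\lambda)_n\frac{t^n}{n!}$ (for $\lambda=0$ this is the limit $e^{yt}$). The convention $0^0=1$ is used. The falling factorials are $(x)_0=1$ and $(x)_n=x(x-1)\cdots(x-n+1)$ for $n\ge1$. The (signed) Stirling numbers of the first kind $S_1(n,k)$ are defined by $(x)_n=\sum_{k=0}^n S_1(n,k)x^k$. The extended degenerate Stirling numbers of the second kind $S_{2,r}(n+r,k+r|\lambda)$ are defined, for $r,k\in\mathbb{N}\cup\{0\}$, by $$\frac{1}{k!}(1+\lambda t)^{r/\lambda}\left((1+\lambda t)^{1/\lambda}-1\right)^k=\sum_{n=k}^\infty S_{2,r}(n+r,k+r|\lambda)\frac{t^n}{n!}.$$ *)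

(* Defs.v *)
From mathcomp Require Import all_boot all_order all_algebra.
From mathcomp Require Import reals.
Set Implicit Arguments.
Unset Strict Implicit.
Unset Printing Implicit Defensive.
Import Order.TTheory GRing.Theory Num.Theory.
Local Open Scope ring_scope.

(* (y|lambda)_n, over any ring so that y may be a number or a polynomial. *)
Definition degen_fact (A : comNzRingType) (y lambda : A) (n : nat) : A :=
  \prod_(i < n) (y - lambda *+ i).

Definition falling (A : comNzRingType) (y : A) (n : nat) : A :=
  \prod_(i < n) (y - i%:R).

(* S_1(n,k) is the coefficient of x^k in (x)_n. *)
Definition stirling1 (n k : nat) : int := (falling ('X : {poly int}) n)`_k.

(* A formal power series in t is its sequence of coefficients:
   f n is the coefficient of t^n (not of t^n/n!). *)
Definition fps (A : Type) := nat -> A.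

Section FPS.
Variable A : comNzRingType.
Implicit Types f g : fps A.

Definition fps_one : fps A := fun n => (n == 0%N)%:R.

Definition fps_sub f g : fps A := fun n => f n - g n.

Definition fps_scale (c : A) f : fps A := fun n => c * f n.

Definition fps_mul f g : fps A :=
  fun n => \sum_(i < n.+1) f i * g (n - i)%N.

Definition fps_exp f (k : nat) : fps A := iter k (fps_mul f) fps_one.

End FPS.

Section DegenerateStirling.
Variable R : realType.
Implicit Types (lambda y : R) (r n k : nat).

(* The power series (1 + lambda t)^(y/lambda).  For lambda = 0 its n-th
   coefficient is y^n/n!, so it is e^(yt). *)
Definition degen_exp lambda y : fps R := fun n => degen_fact y lambda n / n`!%:R.

(* (1/k!) (1 + lambda t)^(r/lambda) ((1 + lambda t)^(1/lambda) - 1)^k *)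
Definition degen_stirling2_gf lambda r k : fps R :=
  fps_scale (k`!%:R)^-1
    (fps_mul (degen_exp lambda r%:R)
       (fps_exp (fps_sub (degen_exp lambda 1) (fps_one R)) k)).

(* degen_stirling2 lambda r n k is S_{2,r}(n+r, k+r | lambda): the indices are
   not shifted by r. *)
Definition degen_stirling2 lambda r n k : R :=
  n`!%:R * degen_stirling2_gf lambda r k n.

Lemma degen_exp1_sub_coef0 lambda :
  fps_sub (degen_exp lambda 1) (fps_one R) 0%N = 0.
Proof.
by rewrite /fps_sub /degen_exp /fps_one /degen_fact big_ord0 divr1 subrr.
Qed.

Lemma fps_exp_coef_lt (f : fps R) k n :
  f 0%N = 0 -> (n < k)%N -> fps_exp f k n = 0.
Proof.
move=> f0; elim: k n => [//|k IH] n ltnk.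
rewrite /fps_exp iterS -/(fps_exp f k) /fps_mul big1 // => -[[|i] lti] _ /=.
  by rewrite f0 mul0r.
rewrite IH ?mulr0 // (leq_trans _ (ltnSE ltnk)) //.
by case: n lti {ltnk} => // n _; rewrite subSS ltnS leq_subr.
Qed.

(* The generating function is the sum of S_{2,r}(n+r, k+r | lambda) t^n/n!
   over n >= k. *)
Lemma degen_stirling2_gfE lambda r k n :
  degen_stirling2_gf lambda r k n =
    if (k <= n)%N then degen_stirling2 lambda r n k / n`!%:R else 0.
Proof.
case: leqP => [_|ltnk].
  by rewrite /degen_stirling2 mulrC mulKf // pnatr_eq0 -lt0n fact_gt0.
rewrite /degen_stirling2_gf /fps_scale /fps_mul big1 ?mulr0 // => i _.
rewrite fps_exp_coef_lt ?mulr0 ?degen_exp1_sub_coef0 //.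
exact: leq_ltn_trans (leq_subr _ _) ltnk.
Qed.

End DegenerateStirling.

(* Main.v *)
Require Import Defs.
From mathcomp Require Import all_boot all_order all_algebra.
From mathcomp Require Import reals.
From mathcomp Require Import ring.
Import GRing.Theory Num.Theory.
Local Open Scope ring_scope.

(** The derivation D = (1 + lambda t) d/dt satisfies D E^y = y E^y for
    E^y = (1 + lambda t)^(y/lambda).  Applied to E^r (E - 1)^k / k!, it yields
    the recurrence
    S(n+1,k) = S(n,k-1) + (k + r - n lambda) S(n,k),
    which is what multiplying (x+r|lambda)_n by x + r - n lambda does to the
    coordinates in the basis (x)_k, since x (x)_k = (x)_(k+1) + k (x)_k.  The
    other expansion follows likewise from the recurrence of S_1. *)

Lemma degen_factS (A : comNzRingType) (y l : A) n :
  degen_fact y l n.+1 = degen_fact y l n * (y - l *+ n).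
Proof. by rewrite /degen_fact big_ord_recr. Qed.

Lemma fallingS (A : comNzRingType) (y : A) n :
  falling y n.+1 = falling y n * (y - n%:R).
Proof. by rewrite /falling big_ord_recr. Qed.

Lemma stirling1S0 n : stirling1 n.+1 0 = - (n%:R * stirling1 n 0).
Proof.
by rewrite /stirling1 fallingS mulrBr coefB coefMX -polyC_natr coefMC sub0r mulrC.
Qed.

Lemma stirling1SS n k :
  stirling1 n.+1 k.+1 = stirling1 n k - n%:R * stirling1 n k.+1.
Proof.
by rewrite /stirling1 fallingS mulrBr coefB coefMX -polyC_natr coefMC mulrC.
Qed.

Lemma stirling1_small n k : (n < k)%N -> stirling1 n k = 0.
Proof.
elim: n k => [|n IHn] [|k] // ltnk.
  by rewrite /stirling1 /falling big_ord0 coef1.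
by rewrite stirling1SS !IHn ?mulr0 ?subr0 // ltnW.
Qed.

(** Multiplication by [w n] is bidiagonal in [b], so the coordinates of [p n] obey the recurrence
    assumed of [T]. Both expansions are instances, with [b] the falling factorials or the powers. *)
Lemma triangular_expansion (A : comNzRingType) (p b w : nat -> A)
    (v T : nat -> nat -> A) :
  p 0 = b 0 -> (forall n, p n.+1 = p n * w n) ->
  (forall n k, b k * w n = b k.+1 + v n k * b k) ->
  T 0 0 = 1 -> (forall n k, (n < k)%N -> T n k = 0) ->
  (forall n, T n.+1 0 = v n 0 * T n 0) ->
  (forall n k, T n.+1 k.+1 = T n k + v n k.+1 * T n k.+1) ->
  forall n, p n = \sum_(k < n.+1) T n k * b k.
Proof.
move=> p0 pS bw T00 T_small TS0 TSS; elim=> [|n IHn].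
  by rewrite big_ord1 T00 mul1r.
have -> : p n.+1 = \sum_(k < n.+1) T n k * b k.+1 +
                   \sum_(k < n.+2) v n k * T n k * b k.
  (* The extra top term contains [T n n.+1 = 0]; the longer range lets both sums align with the
     target after an index shift. *)
  rewrite [X in _ + X]big_ord_recr /= T_small // mulr0 mul0r addr0 -big_split.
  rewrite pS IHn mulr_suml; apply: eq_bigr => k _ /=.
  by rewrite -mulrA bw; ring.
rewrite [X in _ + X = _]big_ord_recl [in RHS]big_ord_recl /= addrCA -big_split TS0.
by congr (_ + _); apply: eq_bigr => k _; rewrite /= TSS mulrDl.
Qed.

(** Here the diagonal term [- (l *+ n)] does not depend on [k]. The ring is arbitrary so that [y]
    can later be the polynomial ['X + r%:R]. *)
Lemma degen_fact_stirling1 (A : comNzRingType) (y l : A) n :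
  degen_fact y l n =
    \sum_(k < n.+1) l ^+ (n - k) * (stirling1 n k)%:~R * y ^+ k.
Proof.
apply: (@triangular_expansion _ (degen_fact y l) (fun k => y ^+ k)
  (fun n => y - l *+ n) (fun n _ => - (l *+ n))
  (fun n k => l ^+ (n - k) * (stirling1 n k)%:~R)).
- by rewrite /degen_fact big_ord0.
- exact: degen_factS.
- by move=> {}n k; rewrite exprS mulrBr mulNr mulrC [_ *+ n * _]mulrC.
- by rewrite /stirling1 /falling big_ord0 coef1 mulr1.
- by move=> {}n k ltnk; rewrite stirling1_small ?mulr0.
- move=> {}n; rewrite stirling1S0 !subn0 exprS rmorphN rmorphM /=.
  by rewrite -[l *+ n]mulr_natr rmorph_nat; ring.
- move=> {}n k; rewrite stirling1SS subSS rmorphB rmorphM /= rmorph_nat.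
  (* For [n <= k] truncated subtraction makes both exponents 0, so no factor [l] can be split off,
     but then [stirling1 n k.+1] vanishes. *)
  have [ltkn|lenk] := ltnP k n; last first.
    by rewrite (@stirling1_small n k.+1) // !mulr0 subr0 addr0.
  by rewrite -[(n - k)%N]subnSK // exprS -[l *+ n]mulr_natr; ring.
Qed.

Section FpsDerivation.
Variables (A : comNzRingType) (l : A).
Implicit Types f g : fps A.

(* (1 + l t) d/dt *)
Definition fps_deriv f : fps A := fun n => n.+1%:R * f n.+1 + l * (n%:R * f n).

Lemma fps_derivM f g n :
  fps_deriv (fps_mul f g) n =
    fps_mul (fps_deriv f) g n + fps_mul f (fps_deriv g) n.
Proof.
(* Leibniz rule for t d/dt, which multiplies the coefficient of t^m by m: split m as i + (m - i).
   Both terms of [fps_deriv] have this shape, at [n.+1] and at [n]. *)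
have euler m : m%:R * fps_mul f g m =
    \sum_(i < m.+1) i%:R * f i * g (m - i)%N +
    \sum_(i < m.+1) f i * ((m - i)%N%:R * g (m - i)%N).
  rewrite /fps_mul mulr_sumr -big_split; apply: eq_bigr => i _ /=.
  have -> : m%:R = i%:R + (m - i)%N%:R :> A.
    by rewrite -natrD subnKC // -ltnS.
  by ring.
(* At [n.+1], the first term of one sum and the last term of the other carry a factor 0; dropping
   them leaves ranges of length [n.+1]. *)
rewrite /fps_deriv !euler big_ord_recl [X in _ + X + _]big_ord_recr /=.
rewrite subnn !mul0r mulr0 add0r addr0 /fps_mul mulrDr addrACA !mulr_sumr.
congr (_ + _); rewrite -big_split; apply: eq_bigr => i _ /=.
  by rewrite /bump /= add1n subSS; ring.
by rewrite subSn -1?ltnS //; ring.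
Qed.

Lemma fps_deriv_one n : fps_deriv (fps_one A) n = 0.
Proof. by case: n => [|n]; rewrite /fps_deriv /fps_one /= !(mulr0, mul0r) addr0. Qed.

Lemma fps_derivB f g n :
  fps_deriv (fps_sub f g) n = fps_deriv f n - fps_deriv g n.
Proof. by rewrite /fps_deriv /fps_sub; ring. Qed.

Lemma eq_fps_mull f f' g n : f =1 f' -> fps_mul f g n = fps_mul f' g n.
Proof. by move=> eqf; apply: eq_bigr => i _; rewrite eqf. Qed.

Lemma eq_fps_mulr f g g' n : g =1 g' -> fps_mul f g n = fps_mul f g' n.
Proof. by move=> eqg; apply: eq_bigr => i _; rewrite eqg. Qed.

Lemma fps_mulZl c f g n : fps_mul (fps_scale c f) g n = c * fps_mul f g n.
Proof. by rewrite mulr_sumr; apply: eq_bigr => i _; rewrite -mulrA. Qed.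

Lemma fps_mul_lin f g h c d n :
  fps_mul f (fun m => c * g m + d * h m) n = c * fps_mul f g n + d * fps_mul f h n.
Proof.
rewrite !mulr_sumr -big_split; apply: eq_bigr => i _ /=.
by ring.
Qed.

Lemma fps_mul1l f n : fps_mul (fps_one A) f n = f n.
Proof.
rewrite /fps_mul big_ord_recl subn0 mul1r big1 ?addr0 // => i _.
by rewrite mul0r.
Qed.

(** This is D(g^k) = k g^(k-1) Dg with Dg = g + 1, the equation satisfied by E - 1. At [k = 0] the
    factor [k%:R] cancels the spurious [k.-1] term. *)
Lemma fps_deriv_exp g k n :
  (forall m, fps_deriv g m = g m + fps_one A m) ->
  fps_deriv (fps_exp g k) n = k%:R * fps_exp g k n + k%:R * fps_exp g k.-1 n.
Proof.
have expS j m : fps_exp g j.+1 m = fps_mul g (fps_exp g j) m by [].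
move=> Dg; elim: k n => [|k IHk] n; first by rewrite fps_deriv_one !mul0r addr0.
rewrite -[LHS]/(fps_deriv (fps_mul g (fps_exp g k)) n) fps_derivM.
rewrite (@eq_fps_mulr _ _ _ _ IHk) fps_mul_lin -expS.
have -> : fps_mul (fps_deriv g) (fps_exp g k) n =
          fps_exp g k.+1 n + fps_exp g k n.
  rewrite expS -[fps_exp g k n in RHS]fps_mul1l -big_split.
  by apply: eq_bigr => i _ /=; rewrite Dg mulrDl.
rewrite -[k.+1.-1]/k; case: k {IHk} => [|k]; first by rewrite !mul0r; ring.
by rewrite -expS -[k.+2%:R]natr1; ring.
Qed.

End FpsDerivation.

Arguments fps_deriv {A}.

Section Recurrence.
Variables (R : realType) (lambda : R).

(** Since (n+1) f_(n+1) = (y - n lambda) f_n, the lambda term of D cancels - n lambda. *)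
Lemma fps_deriv_degen_exp y n :
  fps_deriv lambda (degen_exp lambda y) n = y * degen_exp lambda y n.
Proof.
have fact_neq0 m : m`!%:R != 0 :> R by rewrite pnatr_eq0 -lt0n fact_gt0.
have S_neq0 m : 1 + m%:R != 0 :> R by rewrite nat1r pnatr_eq0.
rewrite /fps_deriv /degen_exp degen_factS factS natrM -mulr_natr.
by field; rewrite fact_neq0 S_neq0.
Qed.

Lemma degen_stirling2_gf_deriv r k n :
  fps_deriv lambda (degen_stirling2_gf lambda r k) n =
    (k + r)%:R * degen_stirling2_gf lambda r k n +
    (0 < k)%N%:R * degen_stirling2_gf lambda r k.-1 n.
Proof.
rewrite /degen_stirling2_gf.
set E := degen_exp lambda r%:R; set G := fps_sub _ _.
(* D kills 1 and fixes E, so D(E - 1) = E = G + 1. *)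
have DG m : fps_deriv lambda G m = G m + fps_one R m.
  by rewrite fps_derivB fps_deriv_degen_exp fps_deriv_one /G /fps_sub; ring.
have -> : fps_deriv lambda (fps_scale k`!%:R^-1 (fps_mul E (fps_exp G k))) n =
          k`!%:R^-1 * fps_deriv lambda (fps_mul E (fps_exp G k)) n.
  by rewrite /fps_deriv /fps_scale; ring.
rewrite fps_derivM /fps_scale.
rewrite (@eq_fps_mulr _ E _ _ n (fun m => fps_deriv_exp _ _ G k m DG)) fps_mul_lin.
rewrite (@eq_fps_mull _ _ _ (fps_exp G k) n (fps_deriv_degen_exp r%:R)).
rewrite -/E -[X in _ * (X + _)]/(fps_mul (fps_scale r%:R E) _ n) fps_mulZl.
(* For positive index, k/k! = 1/(k-1)! turns the lower power of G into the preceding generating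
   function. *)
case: k => [|k]; first by rewrite !mul0r fact0 !addr0 add0n; ring.
have k_fact_neq0 : k`!%:R != 0 :> R by rewrite pnatr_eq0 -lt0n fact_gt0.
have kS_neq0 : 1 + k%:R != 0 :> R by rewrite nat1r pnatr_eq0.
by rewrite /= factS natrM natrD; field; rewrite k_fact_neq0 kS_neq0.
Qed.

(** Compare coefficients of t^n in the differential equation and multiply by n!; the lambda term of
    D, moved across, gives - n lambda. *)
Lemma degen_stirling2S r n k :
  degen_stirling2 lambda r n.+1 k =
    (0 < k)%N%:R * degen_stirling2 lambda r n k.-1 +
    ((k + r)%:R - lambda *+ n) * degen_stirling2 lambda r n k.
Proof.
have := degen_stirling2_gf_deriv r k n.
rewrite /fps_deriv => /(canRL (addrK _)) DFn.
rewrite /degen_stirling2 factS mulnC natrM -mulrA DFn -mulr_natr.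
by ring.
Qed.

Lemma degen_stirling2_small r n k :
  (n < k)%N -> degen_stirling2 lambda r n k = 0.
Proof.
by move=> ltnk; rewrite /degen_stirling2 degen_stirling2_gfE leqNgt ltnk mulr0.
Qed.

Lemma degen_stirling2_00 r : degen_stirling2 lambda r 0 0 = 1.
Proof.
rewrite /degen_stirling2 /degen_stirling2_gf /fps_scale /fps_mul big_ord1.
by rewrite /degen_exp /degen_fact big_ord0 fact0 invr1 !mulr1.
Qed.

Lemma degen_fact_stirling2 r n :
  degen_fact ('X + r%:R : {poly R}) lambda%:P n =
    \sum_(k < n.+1) degen_stirling2 lambda r n k *: falling ('X : {poly R}) k.
Proof.
under eq_bigr do rewrite -mul_polyC.
apply: (@triangular_expansion _ (degen_fact ('X + r%:R) lambda%:P)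
  (falling 'X) (fun n => 'X + r%:R - lambda%:P *+ n)
  (fun n k => ((k + r)%:R - lambda *+ n)%:P)
  (fun n k => (degen_stirling2 lambda r n k)%:P)).
- by rewrite /degen_fact /falling !big_ord0.
- exact: degen_factS.
- move=> {}n k; rewrite fallingS polyCB polyC_natr polyCMn natrD.
  by rewrite -[_ *+ n]mulr_natr; ring.
- by rewrite degen_stirling2_00.
- by move=> {}n k ltnk; rewrite degen_stirling2_small.
- by move=> {}n; rewrite degen_stirling2S mul0r add0r polyCM.
- by move=> {}n k; rewrite degen_stirling2S mul1r polyCD [X in _ + X]polyCM.
Qed.

End Recurrence.

Theorem theorem2p2 (R : realType) (lambda : R) (r n : nat) :
  degen_fact ('X + r%:R : {poly R}) lambda%:P n =
    \sum_(k < n.+1) degen_stirling2 lambda r n k *: falling ('X : {poly R}) k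
  /\
  \sum_(k < n.+1) degen_stirling2 lambda r n k *: falling ('X : {poly R}) k =
    \sum_(k < n.+1)
      (lambda ^+ (n - k) * (stirling1 n k)%:~R) *: ('X + r%:R : {poly R}) ^+ k.
Proof.
split; first exact: degen_fact_stirling2.
rewrite -degen_fact_stirling2 degen_fact_stirling1; apply: eq_bigr => k _.
by rewrite -mul_polyC polyCM polyC_exp -[RHS]/(_ * _) rmorph_int.
Qed.
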